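(* Let $A$ be a regular ring containing a field of characteristic zero, let $m\ge 1$, and let $R=A[X_1,\ldots,X_m]$ be graded by $\deg A=0$ and $\deg X_i=1$ for all $i$. Let $\mathcal{S}$ be the $m$-th Weyl algebra over $A$, graded by $\deg A=0$, $\deg X_i=1$, $\deg\partial_i=-1$. Let $\mathcal{G}$ be a graded Lyubeznik functor on the category ${}^*\mathrm{Mod}(R)$ of graded $R$-modules. Then $\mathcal{G}(R)$ is a generalized Eulerian $\mathcal{S}$-module.
   Context: Regular rings are commutative and Noetherian. The Weyl algebra $\mathcal{S}=A\langle X_1,\ldots,X_m,\partial_1,\ldots,\partial_m\rangle$ has $\partial_i=\partial/\partial X_i$ (elements of $A$ are central); $R$ is a graded subring of $\mathcal S$ and is a graded left $\mathcal S$-module in the usual way. Graded Lyubeznik functors: a homogeneous closed subset of $\operatorname{Spec}(R)$ is one of the form $V(f_1,\ldots,f_s)$ with $f_i$ homogeneous; a homogeneous locally closed subset is $Y=Y''\setminus Y'$ with $Y',Y''$ homogeneous closed (and $Y'\subseteq Y''$). Writing $H^i_Y(-)$ for local cohomology with support in $Y$, there is a long exact sequence of functors on ${}^*\mathrm{Mod}(R)$: $\cdots\to H^i_{Y'}(-)\to H^i_{Y''}(-)\to H^i_Y(-)\to H^{i+1}_{Y'}(-)\to\cdots$. A graded Lyubeznik functor is a composite $\mathcal{T}_1\circ\cdots\circ\mathcal{T}_k$ where each $\mathcal{T}_j$ is either $H^i_{Y_j}(-)$ for a homogeneous locally closed $Y_j$, or the kernel of an arrow in such a long exact sequence for homogeneous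 closed subsets $Y_j'\subset Y_j''$. Module structure: graded Lyubeznik functors carry graded left $\mathcal S$-modules to graded left $\mathcal S$-modules. Namely, for a homogeneous ideal $I$ and a graded $\mathcal S$-module $V$, $H^0_I(V)$ is a graded $\mathcal S$-submodule of $V$; ${}^*$injective graded $\mathcal S$-modules (injective objects in the category of graded $\mathcal S$-modules) are ${}^*$injective over $R$; so $H^i_I(V)$ and $H^i_Y(V)$ are computed from a ${}^*$injective resolution of $V$ over $\mathcal S$ and inherit canonical $\mathcal S$-structures for which the long exact sequence $\cdots\to H^i_{Y'}(V)\to H^i_{Y''}(V)\to H^i_Y(V)\to H^{i+1}_{Y'}(V)\to\cdots$ (with $Y=Y''\setminus Y'$) is $\mathcal S$-linear. $\mathcal G(R)$ has the resulting $\mathcal S$-structure. Generalized Eulerian: let $\mathcal{E}=\sum_{i=1}^m X_i\partial_i$. A graded $\mathcal S$-module $W$ is generalized Eulerian if for each homogeneous $w\in W$, of degree $|w|$, there is a positive integer $a$ (depending on $w$) with $(\mathcal{E}-|w|)^a w=0$. *)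

(* Defs.v *)
(* MathComp with multinomials; boolp gives function types a choice structure. *)
From HB Require Import structures.
From mathcomp Require Import all_boot all_order all_algebra.
From mathcomp Require boolp.
From mathcomp Require Import mpoly.

Set Implicit Arguments.
Unset Strict Implicit.
Unset Printing Implicit Defensive.

Import GRing.Theory.
Local Open Scope ring_scope.

(** * Regular rings *)

Section CommutativeRings.
Variable B : comNzRingType.
Implicit Types (I J P : B -> Prop) (s : seq B).

Definition is_ideal I : Prop :=
  [/\ I 0, forall x y, I x -> I y -> I (x + y)
    & forall b x, I x -> I (b * x)].

Inductive ideal_gen (G : B -> Prop) : B -> Prop :=
| ideal_gen0 : ideal_gen G 0
| ideal_genD b g x : G g -> ideal_gen G x -> ideal_gen G (b * g + x).

Definition span s : B -> Prop := ideal_gen (fun x => x \in s).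

Fixpoint ideal_exp I (n : nat) : B -> Prop :=
  if n is k.+1 then
    ideal_gen (fun z => exists x y, [/\ I x, ideal_exp I k y & z = x * y])
  else fun=> True.

Definition is_prime_ideal P : Prop :=
  [/\ is_ideal P, ~ P 1 & forall x y, P (x * y) -> P x \/ P y].

Definition is_maximal_ideal I : Prop :=
  [/\ is_ideal I, ~ I 1
    & forall J, is_ideal J -> ~ J 1 -> (forall x, I x -> J x) ->
        forall x, J x -> I x].

Definition is_noetherian : Prop :=
  forall I, is_ideal I -> exists s, forall x, I x <-> span s x.

(* a chain P_0 < P_1 < ... < P_n of prime ideals *)
Definition has_prime_chain (n : nat) : Prop :=
  exists P : nat -> B -> Prop,
    (forall i, (i <= n)%N -> is_prime_ideal (P i)) /\
    (forall i, (i < n)%N ->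
       (forall x, P i x -> P i.+1 x) /\ exists x, P i.+1 x /\ ~ P i x).

Definition has_krull_dim (n : nat) : Prop :=
  has_prime_chain n /\ forall k, has_prime_chain k -> (k <= n)%N.

Definition is_regular_local : Prop :=
  is_noetherian /\
  exists M : B -> Prop,
    [/\ is_maximal_ideal M,
        (forall I, is_maximal_ideal I -> forall x, I x <-> M x)
      & exists s, has_krull_dim (size s) /\ forall x, M x <-> span s x].

End CommutativeRings.

(* [phi] exhibits [B] as the localization of [A] at the prime ideal [P]. *)
Definition is_localization_at (A : comNzRingType) (P : A -> Prop)
    (B : comNzRingType) (phi : {rmorphism A -> B}) : Prop :=
  [/\ forall t, ~ P t -> exists b, phi t * b = 1,
      forall b, exists a t, ~ P t /\ b * phi t = phi a
    & forall a, phi a = 0 -> exists t, ~ P t /\ t * a = 0].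

Definition is_regular_ring (A : comNzRingType) : Prop :=
  is_noetherian A /\
  forall P : A -> Prop, is_prime_ideal P ->
  forall (B : comNzRingType) (phi : {rmorphism A -> B}),
    is_localization_at P phi -> is_regular_local B.

Definition contains_field_char0 (A : comNzRingType) : Prop :=
  exists (k : fieldType) (_ : {rmorphism k -> A}), [pchar k] =i pred0.

(** * The Weyl algebra

   As A contains the rationals in the intended use, the Weyl algebra is the
   subring of End_A(A[X]) generated by the multiplications by elements of A
   and by the X_i, and by the partial derivatives d/dX_i. *)

Section Weyl.
Variables (A : comNzRingType) (m : nat).
Local Notation R := {mpoly A[m]}.

Inductive weyl_op : (R -> R) -> Prop :=
| weyl_opC a : weyl_op (fun p => a%:MP * p)
| weyl_opX i : weyl_op (fun p => 'X_i * p)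
| weyl_opd i : weyl_op (fun p => p^`M(i))
| weyl_opB f g : weyl_op f -> weyl_op g -> weyl_op (fun p => f p - g p)
| weyl_opM f g : weyl_op f -> weyl_op g -> weyl_op (fun p => f (g p)).

Record weyl : Type := Weyl { weyl_fun :> R -> R; weylP : weyl_op weyl_fun }.

HB.instance Definition _ := boolp.gen_eqMixin weyl.
HB.instance Definition _ := boolp.gen_choiceMixin weyl.

Lemma weyl_eq (f g : weyl) : f =1 g -> f = g.
Proof.
case: f g => [f fP] [g gP] /= /boolp.funext fg; case: _ / fg in gP *.
by rewrite (boolp.Prop_irrelevance fP gP).
Qed.

Lemma weylB (f : weyl) : {morph f : p q / p - q}.
Proof.
case: f => f /=; elim=> {f} [a|i|i|f g _ fB _ gB|f g _ fB _ gB] p q.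
- exact: mulrBr.
- exact: mulrBr.
- exact: mderivB.
- by rewrite fB gB !opprD addrACA.
- by rewrite gB fB.
Qed.

Lemma weyl0 (f : weyl) : f 0 = 0.
Proof. by have := weylB f 0 0; rewrite !subrr. Qed.

Lemma weylN (f : weyl) : {morph f : p / - p}.
Proof. by move=> p; rewrite -[- p]sub0r weylB weyl0 sub0r. Qed.

Lemma weylD (f : weyl) : {morph f : p q / p + q}.
Proof. by move=> p q; rewrite -{1}[q]opprK weylB weylN opprK. Qed.

Definition wC (a : A) : weyl := Weyl (weyl_opC a).
Definition wX (i : 'I_m) : weyl := Weyl (weyl_opX i).
Definition wd (i : 'I_m) : weyl := Weyl (weyl_opd i).

Definition weyl_sub (f g : weyl) : weyl := Weyl (weyl_opB (weylP f) (weylP g)).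
Definition weyl_mul (f g : weyl) : weyl := Weyl (weyl_opM (weylP f) (weylP g)).
Definition weyl_zero : weyl := wC 0.
Definition weyl_one : weyl := wC 1.
Definition weyl_opp (f : weyl) : weyl := weyl_sub weyl_zero f.
Definition weyl_add (f g : weyl) : weyl := weyl_sub f (weyl_opp g).

Let zeroE p : weyl_zero p = 0. Proof. by rewrite /= mpolyC0 mul0r. Qed.
Let oneE p : weyl_one p = p. Proof. by rewrite /= mpolyC1 mul1r. Qed.
Let oppE f p : weyl_opp f p = - f p.
Proof. by rewrite /= mpolyC0 mul0r sub0r. Qed.
Let addE f g p : weyl_add f g p = f p + g p.
Proof. by rewrite /= mpolyC0 mul0r sub0r opprK. Qed.

Fact weyl_addA : associative weyl_add.
Proof. by move=> f g h; apply: weyl_eq => p; rewrite !addE addrA. Qed.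
Fact weyl_addC : commutative weyl_add.
Proof. by move=> f g; apply: weyl_eq => p; rewrite !addE addrC. Qed.
Fact weyl_add0 : left_id weyl_zero weyl_add.
Proof. by move=> f; apply: weyl_eq => p; rewrite addE zeroE add0r. Qed.
Fact weyl_addN : left_inverse weyl_zero weyl_opp weyl_add.
Proof. by move=> f; apply: weyl_eq => p; rewrite addE oppE zeroE addNr. Qed.

HB.instance Definition _ :=
  GRing.isZmodule.Build weyl weyl_addA weyl_addC weyl_add0 weyl_addN.

Fact weyl_mulA : associative weyl_mul.
Proof. by move=> f g h; apply: weyl_eq. Qed.
Fact weyl_mul1l : left_id weyl_one weyl_mul.
Proof. by move=> f; apply: weyl_eq => p; exact: oneE. Qed.
Fact weyl_mul1r : right_id weyl_one weyl_mul.
Proof. by move=> f; apply: weyl_eq => p; congr (weyl_fun f _); exact: oneE. Qed.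
Fact weyl_mulDl : left_distributive weyl_mul weyl_add.
Proof. by move=> f g h; apply: weyl_eq => p; rewrite [RHS]addE; exact: addE. Qed.
Fact weyl_mulDr : right_distributive weyl_mul weyl_add.
Proof.
move=> f g h; apply: weyl_eq => p; rewrite [RHS]addE.
exact: etrans (congr1 f (addE g h p)) (weylD f _ _).
Qed.
Fact weyl_one_neq0 : weyl_one != 0.
Proof.
apply/eqP => /(congr1 (fun f : weyl => f 1)).
by rewrite oneE zeroE => /eqP; rewrite oner_eq0.
Qed.

HB.instance Definition _ := GRing.Zmodule_isNzRing.Build weyl
  weyl_mulA weyl_mul1l weyl_mul1r weyl_mulDl weyl_mulDr weyl_one_neq0.

Lemma weyl_addE (f g : weyl) p : (f + g) p = f p + g p.
Proof. exact: addE. Qed.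
Lemma weyl_oppE (f : weyl) p : (- f) p = - f p.
Proof. exact: oppE. Qed.
Lemma weyl_mulE (f g : weyl) p : (f * g) p = f (g p).
Proof. by []. Qed.
Lemma weyl_1E p : (1 : weyl) p = p.
Proof. exact: oneE. Qed.
Lemma weyl_0E p : (0 : weyl) p = 0.
Proof. exact: zeroE. Qed.

(* the grading with A, X_i and d_i in degrees 0, 1 and -1 *)
Inductive weyl_deg : int -> weyl -> Prop :=
| weyl_degC a : weyl_deg 0 (wC a)
| weyl_degX i : weyl_deg 1 (wX i)
| weyl_degd i : weyl_deg (- 1) (wd i)
| weyl_degB k f g : weyl_deg k f -> weyl_deg k g -> weyl_deg k (f - g)
| weyl_degM k l f g :
    weyl_deg k f -> weyl_deg l g -> weyl_deg (k + l) (f * g).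

Definition euler : weyl := \sum_(i < m) wX i * wd i.

(* [wR p] is multiplication by p: the inclusion of R as a subring of the Weyl algebra *)
Fact weyl_op_mul (p : R) : weyl_op (fun q => p * q).
Proof.
pose Q (r : R) := weyl_op (fun q => r * q).
have QD r s : Q r -> Q s -> Q (r + s).
  move=> Qr Qs; pose f := Weyl Qr; pose g := Weyl Qs.
  rewrite /Q; have -> : (fun q => (r + s) * q) = (f + g : weyl).
    by apply/boolp.funext => q; rewrite weyl_addE mulrDl.
  exact: weylP.
have QM r s : Q r -> Q s -> Q (r * s).
  move=> Qr Qs; pose f := Weyl Qr; pose g := Weyl Qs.
  rewrite /Q; have -> : (fun q => (r * s) * q) = (f * g : weyl).
    by apply/boolp.funext => q; rewrite weyl_mulE -mulrA.
  exact: weylP.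
have QC a : Q a%:MP by exact: weyl_opC.
rewrite -/(Q p) (mpolyE p); apply: big_ind => // [|e _].
  by rewrite -mpolyC0.
rewrite -mul_mpolyC; apply: (QM) => //; rewrite mpolyXE_id.
apply: (big_ind Q) => // [|i _]; first by rewrite -mpolyC1.
elim: (e i) => [|n IHn]; first by rewrite expr0 -mpolyC1.
by rewrite exprS; apply: QM => //; exact: weyl_opX.
Qed.

Definition wR (p : R) : weyl := Weyl (weyl_op_mul p).

End Weyl.

(** * Graded left modules over the Weyl algebra *)

Section GradedModules.
Variables (A : comNzRingType) (m : nat).
Local Notation R := {mpoly A[m]}.
Local Notation S := (weyl A m).

Record gradedModule : Type := GradedModule {
  gr_sort :> lmodType S;
  gr_comp : int -> gr_sort -> Prop;
  gr_comp0 : forall d, gr_comp d 0;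
  gr_compB : forall d x y, gr_comp d x -> gr_comp d y -> gr_comp d (x - y);
  gr_compZ : forall k d f x,
    weyl_deg k f -> gr_comp d x -> gr_comp (k + d) (f *: x);
  gr_comp_sum : forall x, exists (s : seq int) (c : int -> gr_sort),
    [/\ uniq s, forall d, gr_comp d (c d) & x = \sum_(d <- s) c d];
  gr_comp_free : forall (s : seq int) (c : int -> gr_sort),
    uniq s -> (forall d, gr_comp d (c d)) -> \sum_(d <- s) c d = 0 ->
    forall d, d \in s -> c d = 0
}.

Record gradedHom (M N : gradedModule) : Type := GradedHom {
  gr_map :> {linear M -> N};
  gr_map_comp : forall d x, gr_comp d x -> gr_comp d (gr_map x)
}.

Definition generalized_Eulerian (W : gradedModule) : Prop :=
  forall (d : int) (w : W), gr_comp d w ->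
    exists a : nat, (0 < a)%N /\ (euler A m - d%:~R) ^+ a *: w = 0.

(* injective objects of the category of graded S-modules *)
Definition star_injective (E : gradedModule) : Prop :=
  forall (M N : gradedModule) (i : gradedHom M N) (g : gradedHom M E),
    injective i -> exists h : gradedHom N E, forall x, h (i x) = g x.

Record star_injective_resolution (V : gradedModule) : Type := InjRes {
  res_obj :> nat -> gradedModule;
  res_diff : forall n, gradedHom (res_obj n) (res_obj n.+1);
  res_aug : gradedHom V (res_obj 0%N);
  res_inj : forall n, star_injective (res_obj n);
  res_aug_inj : injective res_aug;
  res_exact0 : forall e : res_obj 0%N,
    res_diff 0 e = 0 <-> exists v, e = res_aug v;
  res_exact : forall n (e : res_obj n.+1),
    res_diff n.+1 e = 0 <-> exists e', e = res_diff n e'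
}.

(** * Local cohomology *)

(* The homogeneous closed subset V(f_1, ..., f_s) of Spec R. *)
Record hclosed : Type := HClosed {
  equations : seq R;
  equations_homog : forall f, f \in equations -> exists n : nat, f \is n.-homog
}.

Definition in_hclosed (Y : hclosed) (P : R -> Prop) : Prop :=
  is_prime_ideal P /\ forall f, f \in equations Y -> P f.

(* The homogeneous locally closed subset Y = Y'' \ Y'. *)
Record hlocclosed : Type := HLocClosed {
  outer : hclosed;
  inner : hclosed;
  inner_outer : forall P, in_hclosed inner P -> in_hclosed outer P
}.

(* H^0_I(M), where I is the ideal generated by the equations of Y; R being
   Noetherian, this is the submodule of elements supported on Y. *)
Definition Gamma (Y : hclosed) (M : gradedModule) : M -> Prop :=
  fun x => exists n : nat,
    forall r, ideal_exp (span (equations Y)) n r -> wR r *: x = 0.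

(* [pi] induces an isomorphism of graded S-modules from the subquotient P/Q
   of M to W; its values outside the submodule P are irrelevant. *)
Definition is_subquotient (M : gradedModule) (P Q : M -> Prop)
    (W : gradedModule) (pi : M -> W) : Prop :=
  [/\ forall (f : S) x y, P x -> P y -> pi (f *: x + y) = f *: pi x + pi y,
      forall d x, P x -> gr_comp d x -> gr_comp d (pi x),
      forall w, exists x, P x /\ pi x = w
    & forall x, P x -> (pi x = 0 <-> Q x)].

Section Cohomology.
Variables (V : gradedModule) (E : star_injective_resolution V).
(* two subcomplexes T <= U of E; below, the cohomology of U/T *)
Variables (U T : forall n, E n -> Prop).

Definition cocycle (i : nat) (e : E i) : Prop :=
  U e /\ T (res_diff E i e).

Definition coboundary (i : nat) : E i -> Prop :=
  match i with
  | 0 => fun e => T e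
  | j.+1 => fun e => exists e', U e' /\ T (e - res_diff E j e')
  end.

Definition is_cohomology (i : nat) (H : gradedModule) (pi : E i -> H) : Prop :=
  is_subquotient (@cocycle i) (@coboundary i) pi.

End Cohomology.

(* H^i_Z(V) for Z closed *)
Definition is_H_closed (V : gradedModule) (E : star_injective_resolution V)
    (Z : hclosed) (i : nat) (H : gradedModule) (pi : E i -> H) : Prop :=
  is_cohomology (fun n => @Gamma Z (E n)) (fun n e => e = 0) pi.

(* H^i_Y(V) for Y = Y'' \ Y', the cohomology of
   Gamma_Y(E) = Gamma_Y''(E) / Gamma_Y'(E).  Taking V(1) for Y' gives the case
   of a closed Y, since Gamma_V(1) = 0. *)
Definition is_H_locclosed (V : gradedModule) (E : star_injective_resolution V)
    (Y : hlocclosed) (i : nat) (H : gradedModule) (pi : E i -> H) : Prop :=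
  is_cohomology (fun n => @Gamma (outer Y) (E n))
                (fun n => @Gamma (inner Y) (E n)) pi.

Definition is_kernel (M N : gradedModule) (f : gradedHom M N)
    (K : gradedModule) : Prop :=
  exists j : gradedHom K M, injective j /\
    forall x, f x = 0 <-> exists k, x = j k.

(* The arrows of the long exact sequence attached to
   0 -> Gamma_Y'(E) -> Gamma_Y''(E) -> Gamma_Y(E) -> 0:
     les_into i       :  H^i_Y'  -> H^i_Y''
     les_onto i       :  H^i_Y'' -> H^i_Y
     les_connecting i :  H^i_Y   -> H^{i+1}_Y'  *)
Inductive les_arrow : Type :=
| les_into of nat
| les_onto of nat
| les_connecting of nat.

Definition is_les_arrow (V : gradedModule) (E : star_injective_resolution V)
    (Y : hlocclosed) (a : les_arrow) (M N : gradedModule)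
    (f : gradedHom M N) : Prop :=
  match a with
  | les_into i => exists (pi : E i -> M) (pi' : E i -> N),
      [/\ is_H_closed (inner Y) pi, is_H_closed (outer Y) pi'
        & forall e, Gamma (inner Y) e -> res_diff E i e = 0 ->
            f (pi e) = pi' e]
  | les_onto i => exists (pi : E i -> M) (pi' : E i -> N),
      [/\ is_H_closed (outer Y) pi, is_H_locclosed Y pi'
        & forall e, Gamma (outer Y) e -> res_diff E i e = 0 ->
            f (pi e) = pi' e]
  | les_connecting i => exists (pi : E i -> M) (pi' : E i.+1 -> N),
      [/\ is_H_locclosed Y pi, is_H_closed (inner Y) pi'
        & forall e, Gamma (outer Y) e -> Gamma (inner Y) (res_diff E i e) ->
            f (pi e) = pi' (res_diff E i e)]
  end.

(** * Graded Lyubeznik functors *)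

Inductive basic_functor : Type :=
| local_cohomology of nat & hlocclosed
| les_kernel of les_arrow & hlocclosed.

(* [Comp T G] is the functor T \o G. *)
Inductive lyubeznik_functor : Type :=
| Basic of basic_functor
| Comp of basic_functor & lyubeznik_functor.

(* [basic_value T V W] and [lyubeznik_value G V W] state that W is a value of
   the functor at V: values are determined up to isomorphism of graded
   S-modules, any star-injective resolution of V over S being allowed. *)
Definition basic_value (T : basic_functor) (V W : gradedModule) : Prop :=
  exists E : star_injective_resolution V,
  match T with
  | local_cohomology i Y => exists pi : E i -> W, is_H_locclosed Y pi
  | les_kernel a Y => exists (M N : gradedModule) (f : gradedHom M N),
      is_les_arrow E Y a f /\ is_kernel f W
  end.

Fixpoint lyubeznik_value (G : lyubeznik_functor) (V W : gradedModule) : Prop :=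
  match G with
  | Basic T => basic_value T V W
  | Comp T G' => exists U, lyubeznik_value G' V U /\ basic_value T U W
  end.

(** * The polynomial ring as a graded module over the Weyl algebra *)

Definition polyS : Type := R.
HB.instance Definition _ := GRing.Zmodule.on polyS.

Definition polyS_scale (f : S) (p : polyS) : polyS := f p.

Fact polyS_scaleA f g p :
  polyS_scale f (polyS_scale g p) = polyS_scale (f * g) p.
Proof. by []. Qed.
Fact polyS_scale1 : left_id 1 polyS_scale.
Proof. exact: weyl_1E. Qed.
Fact polyS_scaleDr : right_distributive polyS_scale +%R.
Proof. exact: weylD. Qed.
Fact polyS_scaleDl p : {morph polyS_scale^~ p : f g / f + g}.
Proof. by move=> f g; exact: weyl_addE. Qed.

HB.instance Definition _ := GRing.Zmodule_isLmodule.Build S polyS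
  polyS_scaleA polyS_scale1 polyS_scaleDr polyS_scaleDl.

Definition polyS_comp (d : int) (p : polyS) : Prop :=
  match d with
  | Posz n => (p : R) \is n.-homog
  | Negz _ => p = 0
  end.

Fact polyS_comp0 d : polyS_comp d 0.
Proof. by case: d => n //=; exact: rpred0. Qed.

Fact polyS_compB d p q :
  polyS_comp d p -> polyS_comp d q -> polyS_comp d (p - q).
Proof.
case: d => n /=; first exact: rpredB.
by move=> -> ->; rewrite subrr.
Qed.

Fact polyS_compZ k d f p :
  weyl_deg k f -> polyS_comp d p -> polyS_comp (k + d) (f *: p).
Proof.
have compP e (q : R) : polyS_comp e q <->
    forall m0, m0 \in msupp q -> (mdeg m0)%:Z = e.
  case: e => n /=; split.
  - by move=> /dhomogP h m0 /h ->.
  - by move=> h; apply/dhomogP => m0 /h [].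
  - by move=> ->; rewrite msupp0.
  - move=> h; apply/eqP; rewrite -msupp_eq0; case: (msupp q) h => // m0 s.
    by move/(_ m0 (mem_head _ _)).
move=> fk; elim: fk d p => {k f} [a|i|i|k f g _ fP _ gP|k l f g _ fP _ gP] d p pd.
- rewrite add0r; apply/compP => m0 m0p; apply: (compP d p).1 => //.
  have : m0 \in msupp (a *: (p : R)) by rewrite -mul_mpolyC.
  exact: msuppZ_le.
- apply/compP => m0.
  have -> : (wX A i *: p : R) = (p : R) * 'X_i by exact: mulrC.
  rewrite (perm_mem (msuppMX _ _)) => /mapP[m1 m1p ->].
  by rewrite mdegD mdeg1 PoszD (compP d p).1.
- apply/compP => m0.
  have -> : (wd A i *: p : R) = (p : R)^`M(i) by [].
  rewrite mcoeff_msupp mcoeff_deriv.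
  move=> nz; have m0p : (m0 + U_(i))%MM \in msupp (p : R).
    by rewrite mcoeff_msupp; apply: contra_neq nz => ->; rewrite mul0rn.
  have /= <- := (compP d p).1 pd _ m0p.
  by rewrite mdegD mdeg1 PoszD addrC addrK.
- by rewrite scalerBl; apply: polyS_compB; [exact: fP | exact: gP].
- by rewrite -scalerA -addrA; apply: fP; exact: gP.
Qed.

Fact polyS_comp_sum p : exists (s : seq int) (c : int -> polyS),
  [/\ uniq s, forall d, polyS_comp d (c d) & p = \sum_(d <- s) c d].
Proof.
pose c (d : int) : R := if d is Posz n then pihomog mdeg n p else 0.
exists [seq Posz n | n <- iota 0 (msize (p : R))], c; split.
- by rewrite map_inj_uniq ?iota_uniq // => ? ? [].
- by case=> n //=; exact: pihomogP.
- rewrite big_map -{1}[msize _]subn0 -/(index_iota 0 _) big_mkord.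
  exact: (pihomog_partitionE (mf := mdeg)).
Qed.

Fact polyS_comp_free (s : seq int) (c : int -> polyS) :
  uniq s -> (forall d, polyS_comp d (c d)) -> \sum_(d <- s) c d = 0 ->
  forall d, d \in s -> c d = 0.
Proof.
move=> s_uniq cP sum0 [n|n] ns; last exact: (cP (Negz n)).
have := congr1 (pihomog mdeg n : R -> R) sum0.
rewrite pihomog0 (raddf_sum (pihomog mdeg n : {linear R -> R})).
rewrite (bigD1_seq (Posz n)) //= (pihomog_dE (cP (Posz n))).
rewrite big1 ?addr0 // => -[k|k] kn; last by rewrite (cP (Negz k)) pihomog0.
by apply: pihomog_ne0 (cP (Posz k)); apply: contra_neq kn => ->.
Qed.

Definition polyRing_module : gradedModule :=
  GradedModule polyS_comp0 polyS_compB polyS_compZ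
    polyS_comp_sum polyS_comp_free.

End GradedModules.

(* Main.v *)
Require Import Defs.
From HB Require Import structures.
From mathcomp Require Import all_boot all_order all_algebra.
From mathcomp Require boolp.
From mathcomp Require Import mpoly.

(** Every value W of a graded Lyubeznik functor at R is even Eulerian in the
    strict sense: (euler - |w|) w = 0 for all homogeneous w.

    On any graded module M over the Weyl algebra S, let theta be the additive
    map that sends a homogeneous w to (euler - |w|) w. Since [euler, s] = k s
    for s in S of degree k ([euler_comm]), theta is S-linear ([thetaZ]); it
    preserves degrees and commutes with all graded homomorphisms
    ([theta_natural]). So theta is a natural endomorphism of the identity
    functor, and M is Eulerian if and only if theta vanishes on M.

    Euler's identity gives theta = 0 on R ([polyRing_eulerian]). Suppose that
    theta = 0 on V and let E be a *injective resolution of V over S. The maps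
    theta on the terms of E form a lift of theta = 0 on V, so they are
    null-homotopic by S-linear graded maps ([homotopy0], [homotopyS]). A
    homotopy of graded S-linear maps restricts to the subcomplexes of sections
    with support in a closed subset, and descends to their quotients, so theta
    induces zero on all modules H^i_Y(V). By naturality the induced map is the
    theta of H^i_Y(V), which is therefore Eulerian ([cohomology_eulerian]).
    Submodules of Eulerian modules are Eulerian, which settles the kernels of
    arrows of the long exact sequence, and an induction on the number of factors
    of the functor concludes. *)

Set Implicit Arguments.
Unset Strict Implicit.
Unset Printing Implicit Defensive.

Import GRing.Theory.
Local Open Scope ring_scope.

(** * The Euler operator and the grading of the Weyl algebra *)

Section EulerOperator.
Variables (A : comNzRingType) (m : nat).
Local Notation R := {mpoly A[m]}.
Local Notation S := (weyl A m).
Local Notation euler := (euler A m).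

Lemma eulerE (p : R) : euler p = \sum_(i < m) 'X_i * p^`M(i).
Proof.
pose ev (f : S) := f p.
have evD : {morph ev : f g / f + g} by move=> f g; exact: weyl_addE.
have ev0 : ev 0 = 0 := weyl_0E p.
by rewrite -[LHS]/(ev (\sum_(i < m) wX A i * wd A i)) (big_morph ev evD ev0).
Qed.

Lemma eulerM (p q : R) : euler (p * q) = euler p * q + p * euler q.
Proof.
rewrite !eulerE mulr_suml mulr_sumr -big_split; apply: eq_bigr => i _ /=.
by rewrite mderivM mulrDr [X in X + _]mulrA ['X_i * (p * _)]mulrCA.
Qed.

Lemma mderiv_var (i j : 'I_m) : ('X_i : R)^`M(j) = (i == j)%:R.
Proof.
rewrite mderivX mnm1E; case: eqP => [->|_]; last by rewrite scale0r.
have -> : (U_(j) - U_(j))%MM = 0%MM :> 'X_{1..m}.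
  by apply/mnmP => k; rewrite mnmBE subnn mnm0E.
by rewrite mpolyX0 scale1r.
Qed.

Lemma eulerX (i : 'I_m) : euler 'X_i = 'X_i.
Proof.
rewrite eulerE (bigD1 i) //= mderiv_var eqxx mulr1 big1 ?addr0 // => j ji.
by rewrite mderiv_var eq_sym (negPf ji) mulr0.
Qed.

Lemma eulerC (a : A) : euler a%:MP = 0.
Proof. by rewrite eulerE big1 // => i _; rewrite mderivC mulr0. Qed.

Lemma euler_deriv (i : 'I_m) (p : R) :
  euler (p^`M(i)) = (euler p)^`M(i) - p^`M(i).
Proof.
rewrite !eulerE raddf_sum /= (bigD1 i) //= [X in _ = X - _](bigD1 i) //=.
rewrite mderivM mderiv_var eqxx mul1r.
rewrite -!addrA [RHS]addrC -!addrA addNr addr0; congr (_ + _).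
apply: eq_bigr => j ji.
by rewrite mderivM mderiv_var (negPf ji) mul0r add0r mderiv_comm.
Qed.

(** This is [euler, s] = k s, which says that the inner derivation of euler
    is the grading of the Weyl algebra; both sides are derivations in s, so the
    generators decide. *)
Lemma euler_comm k (s : S) :
  weyl_deg k s -> euler * s = s * (euler + k%:~R).
Proof.
elim=> {k s} [a|i|i|k f g _ fE _ gE|k l f g _ fE _ gE].
- rewrite addr0; apply: weyl_eq => p.
  by rewrite !weyl_mulE /= eulerM eulerC mul0r add0r.
- rewrite mulrDr mulr1; apply: weyl_eq => p.
  by rewrite weyl_addE !weyl_mulE /= eulerM eulerX addrC.
- rewrite mulrDr mulrN1; apply: weyl_eq => p.
  by rewrite weyl_addE weyl_oppE !weyl_mulE /= euler_deriv.
- by rewrite mulrBr mulrBl fE gE.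
- rewrite mulrA fE -!mulrA mulrDl gE; congr (_ * _).
  by rewrite -(commr_int g k) -mulrDr -addrA rmorphD [k%:~R + _]addrC.
Qed.

Lemma wRD : {morph @wR A m : p q / p + q}.
Proof. by move=> p q; apply: weyl_eq => r; rewrite weyl_addE /= mulrDl. Qed.

Lemma wRM : {morph @wR A m : p q / p * q}.
Proof. by move=> p q; apply: weyl_eq => r; rewrite weyl_mulE /= mulrA. Qed.

Lemma wR0 : wR (0 : R) = 0.
Proof. by apply: weyl_eq => r; rewrite weyl_0E /= mul0r. Qed.

Lemma wR1 : wR (1 : R) = 1.
Proof. by apply: weyl_eq => r; rewrite weyl_1E /= mul1r. Qed.

Lemma weyl_degD k (f g : S) :
  weyl_deg k f -> weyl_deg k g -> weyl_deg k (f + g).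
Proof.
move=> fk gk; have -> : f + g = f - (g - g - g) by rewrite subrr sub0r opprK.
by do ?apply: weyl_degB.
Qed.

Lemma weyl_deg_wRXn i n : weyl_deg n%:Z (wR ('X_i ^+ n : R)).
Proof.
elim: n => [|n IH].
  suff -> : wR ('X_i ^+ 0 : R) = wC m 1 by exact: weyl_degC.
  by apply: weyl_eq => r.
rewrite exprS wRM intS; apply: weyl_degM => //.
suff -> : wR ('X_i : R) = wX A i by exact: weyl_degX.
exact: weyl_eq.
Qed.

Lemma weyl_deg_wRX (e : 'X_{1..m}) : weyl_deg (mdeg e)%:Z (wR ('X_[e] : R)).
Proof.
rewrite mpolyXE_id mdegE.
elim/big_ind2: _ => [|p k q l pk ql|i _]; last exact: weyl_deg_wRXn.
- suff -> : wR (1 : R) = wC m 1 by exact: weyl_degC.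
  by apply: weyl_eq => r.
- by rewrite wRM PoszD; apply: weyl_degM.
Qed.

(** Zero is homogeneous of every degree in R, but [weyl_deg] gives it a degree
    only if it can build an operator of that degree; hence the disjunction. *)
Lemma weyl_deg_wR n (f : R) :
  f \is n.-homog -> wR f = 0 \/ weyl_deg n%:Z (wR f).
Proof.
move=> /dhomogP fn; rewrite (mpolyE f) big_seq.
apply: (big_ind (fun p : R => wR p = 0 \/ weyl_deg n%:Z (wR p))) => [|p q|e ef].
- by left; rewrite wR0.
- rewrite wRD => -[->|pn] [->|qn]; rewrite ?addr0 ?add0r; [by left|by right..|].
  by right; apply: weyl_degD.
- right; rewrite -(fn e ef).
  rewrite -mul_mpolyC wRM -[Posz _]add0r; apply: weyl_degM (weyl_deg_wRX e).
  suff -> : wR (f@_e)%:MP = wC m f@_e by exact: weyl_degC.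
  exact: weyl_eq.
Qed.

End EulerOperator.

(** * Homogeneous components *)

Section Components.
Variables (A : comNzRingType) (m : nat) (M : gradedModule A m).
Local Notation S := (weyl A m).
Implicit Types (x y : M) (c : int -> M) (s : seq int).

Lemma gr_compN d x : gr_comp d x -> gr_comp d (- x).
Proof. by move=> xd; rewrite -sub0r; apply: gr_compB (gr_comp0 _ _) xd. Qed.

Lemma gr_compD d x y : gr_comp d x -> gr_comp d y -> gr_comp d (x + y).
Proof. by move=> xd yd; rewrite -[y]opprK; apply/gr_compB/gr_compN. Qed.

Lemma gr_compMz d x k : gr_comp d x -> gr_comp d (x *~ k).
Proof.
move=> xd; have nat_case n : gr_comp d (x *+ n).
  elim: n => [|n IHn]; first by rewrite mulr0n; exact: gr_comp0.
  by rewrite mulrS; exact: gr_compD.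
case: k => n; first exact: nat_case.
by rewrite NegzE mulrNz; exact: gr_compN (nat_case _).
Qed.

Lemma decompositionP x : exists sc : seq int * (int -> M),
  [/\ uniq sc.1, forall d, gr_comp d (sc.2 d) & x = \sum_(d <- sc.1) sc.2 d].
Proof. by have [s [c h]] := gr_comp_sum x; exists (s, c). Qed.

Let decomposition x := sval (boolp.cid (decompositionP x)).

(** The degrees listed by a chosen decomposition of x; some of the listed
    components may vanish. *)
Definition hsupp x : seq int := (decomposition x).1.

(** Degrees outside [hsupp x] get the component 0, since the chosen family
    may take arbitrary values there. *)
Definition hcomp (d : int) x : M :=
  if d \in hsupp x then (decomposition x).2 d else 0.

Lemma hsupp_uniq x : uniq (hsupp x).
Proof. by rewrite /hsupp /decomposition; case: boolp.cid => sc []. Qed.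

Lemma hcompP d x : gr_comp d (hcomp d x).
Proof.
rewrite /hcomp /decomposition; case: boolp.cid => sc [_ scP _] /=.
by case: ifP => _; [exact: scP | exact: gr_comp0].
Qed.

Lemma sum_extend s t c : uniq s -> uniq t -> {subset s <= t} ->
  \sum_(d <- t) (if d \in s then c d else 0) = \sum_(d <- s) c d.
Proof.
move=> us ut st; rewrite -big_mkcond -big_filter; apply: perm_big.
apply: uniq_perm; rewrite ?filter_uniq // => d; rewrite mem_filter /=.
by case ds: (d \in s) => //=; exact: st.
Qed.

Lemma hcomp_sum s x : uniq s -> {subset hsupp x <= s} ->
  x = \sum_(d <- s) hcomp d x.
Proof.
move=> us xs; rewrite sum_extend ?hsupp_uniq //.
by rewrite /hsupp /decomposition; case: boolp.cid => sc [].
Qed.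

(** The components do not depend on the decomposition: extend two of them by
    zero to a common list of degrees and subtract. *)
Lemma hcompE s c x d : uniq s -> (forall e, gr_comp e (c e)) ->
  x = \sum_(e <- s) c e -> hcomp d x = if d \in s then c d else 0.
Proof.
move=> us cP xE.
have c'P e : gr_comp e (if e \in s then c e else 0).
  by case: ifP => _; [exact: cP | exact: gr_comp0].
pose t := undup (s ++ hsupp x).
have ut : uniq t by exact: undup_uniq.
have st : {subset s <= t} by move=> e es; rewrite mem_undup mem_cat es.
have xt : {subset hsupp x <= t}.
  by move=> e es; rewrite mem_undup mem_cat es orbT.
have := xE; rewrite -(sum_extend _ us ut st) [LHS](hcomp_sum ut xt).
move/eqP; rewrite -subr_eq0 -sumrB => /eqP.
move/(gr_comp_free ut (fun e => gr_compB (hcompP e x) (c'P e))) => free.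
have [/free/eqP|] := boolP (d \in t); first by rewrite subr_eq0 => /eqP.
rewrite mem_undup mem_cat negb_or => /andP[/negPf -> /negPf dx].
by rewrite /hcomp dx.
Qed.

Lemma hcomp_homog d e x :
  gr_comp d x -> hcomp e x = if e == d then x else 0.
Proof.
move=> xd; pose c e := if e == d then x else 0.
have cP k : gr_comp k (c k).
  by rewrite /c; case: eqP => [->|_] //; exact: gr_comp0.
rewrite (@hcompE [:: d] c x e) //; last by rewrite big_seq1 /c eqxx.
by rewrite inE /c; case: (e == d).
Qed.

Lemma hcompB d x y : hcomp d (x - y) = hcomp d x - hcomp d y.
Proof.
pose s := undup (hsupp x ++ hsupp y).
have us : uniq s by exact: undup_uniq.
have xs : {subset hsupp x <= s} by move=> e h; rewrite mem_undup mem_cat h.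
have ys : {subset hsupp y <= s} by move=> e h; rewrite mem_undup mem_cat h orbT.
rewrite (@hcompE s (fun e => hcomp e x - hcomp e y)) //; first last.
- by rewrite sumrB -!hcomp_sum.
- by move=> e; apply/gr_compB; exact: hcompP.
case: ifPn => //; rewrite mem_undup mem_cat negb_or /hcomp.
by case/andP=> /negPf -> /negPf ->; rewrite subrr.
Qed.

HB.instance Definition _ d :=
  GRing.isZmodMorphism.Build M M (hcomp d) (hcompB d).

(** Reduces naturality and linearity statements to homogeneous elements,
    where components and theta have closed forms. *)
Lemma homog_ind (P : M -> Prop) :
  P 0 -> (forall x y, P x -> P y -> P (x + y)) ->
  (forall d x, gr_comp d x -> P x) -> forall x, P x.
Proof.
move=> P0 PD Ph x; rewrite (hcomp_sum (hsupp_uniq x) (fun e h => h)).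
by elim/big_ind: _ => // d _; exact: Ph (hcompP d x).
Qed.

Lemma hcompZ k d (f : S) x :
  weyl_deg k f -> hcomp (k + d) (f *: x) = f *: hcomp d x.
Proof.
move=> fk; elim/homog_ind: x => [|x y IHx IHy|e x xe].
- by rewrite scaler0 !raddf0.
- by rewrite scalerDr !raddfD /= IHx IHy.
- rewrite (hcomp_homog _ (gr_compZ fk xe)) (hcomp_homog _ xe).
  by rewrite (inj_eq (addrI k)); case: ifP; rewrite ?scaler0.
Qed.

End Components.

(** * The endomorphism theta of a graded module *)

Section GradedHoms.
Variables (A : comNzRingType) (m : nat).
Local Notation S := (weyl A m).
Implicit Types M N L : gradedModule A m.

Definition mkGradedHom M N (f : M -> N) (fL : linear f)
    (fC : forall d x, gr_comp d x -> gr_comp d (f x)) : gradedHom M N :=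
  let F := HB.pack_for {linear M -> N} f
    (GRing.isLinear.Build S M N *:%R f fL) in
  @GradedHom A m M N F fC.

Lemma hcomp_hom M N (f : gradedHom M N) d x : hcomp d (f x) = f (hcomp d x).
Proof.
elim/homog_ind: x => [|x y IHx IHy|e x xe].
- by rewrite !raddf0.
- by rewrite !raddfD /= IHx IHy.
- rewrite (hcomp_homog _ (gr_map_comp f xe)) (hcomp_homog _ xe).
  by case: ifP; rewrite ?raddf0.
Qed.

Lemma hom_sub_comp_linear M N L (f : gradedHom M N) (g : gradedHom M L)
    (h : gradedHom L N) : linear (fun x => f x - h (g x)).
Proof.
by move=> a x y; rewrite !linearP /= addrACA -scalerDr.
Qed.

Definition hom_sub_comp M N L (f : gradedHom M N) (g : gradedHom M L)
    (h : gradedHom L N) : gradedHom M N :=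
  mkGradedHom (hom_sub_comp_linear f g h)
    (fun d x xd => gr_compB (gr_map_comp f xd)
                     (gr_map_comp h (gr_map_comp g xd))).

Lemma hom_sub_compE M N L (f : gradedHom M N) (g : gradedHom M L)
    (h : gradedHom L N) x : hom_sub_comp f g h x = f x - h (g x).
Proof. by []. Qed.

Section Theta.
Variable M : gradedModule A m.
Local Notation euler := (euler A m).

(** The additive extension of w |-> (euler - |w|) w. A graded module is
    generalized Eulerian exactly when this endomorphism is locally nilpotent. *)
Definition theta (x : M) : M :=
  \sum_(d <- hsupp x) (euler - d%:~R) *: hcomp d x.

Lemma thetaE s x : uniq s -> {subset hsupp x <= s} ->
  theta x = \sum_(d <- s) (euler - d%:~R) *: hcomp d x.
Proof.
move=> us xs; rewrite /theta -(sum_extend _ (hsupp_uniq x) us xs).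
apply: eq_bigr => d _; case: ifPn => // dx.
by rewrite /hcomp (negPf dx) scaler0.
Qed.

Lemma theta_homog d x : gr_comp d x -> theta x = (euler - d%:~R) *: x.
Proof.
move=> xd; pose s := undup (d :: hsupp x).
rewrite (@thetaE s) ?undup_uniq //; last first.
  by move=> e h; rewrite mem_undup inE h orbT.
rewrite (bigD1_seq d) ?undup_uniq ?mem_undup ?mem_head //=.
rewrite (hcomp_homog _ xd) eqxx big1 ?addr0 // => e /negPf ed.
by rewrite (hcomp_homog _ xd) ed scaler0.
Qed.

Lemma thetaB : {morph theta : x y / x - y}.
Proof.
move=> x y; pose s := undup (hsupp x ++ hsupp y ++ hsupp (x - y)).
have us : uniq s by exact: undup_uniq.
rewrite !(thetaE us) => [||e h|e h]; try by rewrite mem_undup !mem_cat h ?orbT.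
  by rewrite -sumrB; apply: eq_bigr => d _; rewrite raddfB /= scalerBr.
by move=> e h; rewrite mem_undup !mem_cat h ?orbT.
Qed.

HB.instance Definition _ := GRing.isZmodMorphism.Build M M theta thetaB.

(** Passing from w to f w, both euler (by [euler_comm]) and the degree are
    shifted by k, and the two shifts cancel. *)
Lemma thetaZ_homog k (f : S) x : weyl_deg k f -> theta (f *: x) = f *: theta x.
Proof.
move=> fk; elim/homog_ind: x => [|x y IHx IHy|d x xd].
- by rewrite scaler0 !raddf0.
- by rewrite scalerDr !raddfD /= IHx IHy.
- rewrite (theta_homog (gr_compZ fk xd)) (theta_homog xd) !scalerA.
  congr (_ *: _); rewrite mulrBl mulrBr (euler_comm fk) mulrDr.
  by rewrite -(commr_int f (k + d)) rmorphD mulrDr opprD addrA addrK.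
Qed.

(** The operators that commute with theta form a subring, and it contains
    the generators, which are homogeneous. *)
Lemma thetaZ (f : S) x : theta (f *: x) = f *: theta x.
Proof.
(* [weyl_op] is proof-irrelevant, so the induction is on the function g and
   f ranges over the operators with this underlying function. *)
have [g gE] : exists g, g = weyl_fun f by exists f.
have := weylP f; rewrite -gE => gP; elim: gP f x gE => {g}
  [a|i|i|g h gP IHg hP IHh|g h gP IHg hP IHh] f x fE.
- have -> : f = wC m a by apply: weyl_eq => p; rewrite -fE.
  exact: (thetaZ_homog _ (weyl_degC m a)).
- have -> : f = wX A i by apply: weyl_eq => p; rewrite -fE.
  exact: (thetaZ_homog _ (weyl_degX A i)).
- have -> : f = wd A i by apply: weyl_eq => p; rewrite -fE.
  exact: (thetaZ_homog _ (weyl_degd A i)).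
- have -> : f = Weyl gP - Weyl hP.
    by apply: weyl_eq => p; rewrite weyl_addE weyl_oppE -fE.
  by rewrite !scalerBl raddfB /= !(IHg (Weyl gP), IHh (Weyl hP)).
- have -> : f = Weyl gP * Weyl hP by apply: weyl_eq => p; rewrite -fE.
  by rewrite -!scalerA (IHg (Weyl gP)) // (IHh (Weyl hP)).
Qed.

Lemma theta_linear : linear theta.
Proof. by move=> a x y; rewrite raddfD /= thetaZ. Qed.

Lemma theta_comp d x : gr_comp d x -> gr_comp d (theta x).
Proof.
move=> xd; rewrite (theta_homog xd) scalerBl; apply: gr_compB.
  rewrite /euler scaler_suml; elim/big_ind: _ => [|y z yd zd|i _].
  - exact: gr_comp0.
  - exact: gr_compD.
  - rewrite -[d]add0r -(subrr 1); apply: gr_compZ xd.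
    exact: weyl_degM (weyl_degX _ _) (weyl_degd _ _).
by rewrite scaler_int; exact: gr_compMz.
Qed.

Definition theta_hom : gradedHom M M := mkGradedHom theta_linear theta_comp.

End Theta.
End GradedHoms.

(** * Extension of maps to *injective modules *)

Section Image.
Variables (A : comNzRingType) (m : nat) (M N : gradedModule A m).
Variable f : gradedHom M N.
Local Notation S := (weyl A m).

Definition im_pred : {pred N} := fun y => boolp.asbool (exists x, f x = y).

Fact im_closed : submod_closed im_pred.
Proof.
split=> [|a _ _ /boolp.asboolP[x <-] /boolp.asboolP[y <-]]; apply/boolp.asboolP.
  by exists 0; rewrite raddf0.
by exists (a *: x + y); rewrite linearP.
Qed.

HB.instance Definition _ := GRing.isSubmodClosed.Build S N im_pred im_closed.

Record image : Type := Image { imval :> N; imvalP : imval \in im_pred }.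
HB.instance Definition _ := [isSub for imval].
HB.instance Definition _ := [Choice of image by <:].
HB.instance Definition _ := [SubChoice_isSubLmodule of image by <:].

Definition im_comp (d : int) (y : image) : Prop := gr_comp d (imval y).

Fact im_comp0 d : im_comp d 0. Proof. exact: gr_comp0. Qed.
Fact im_compB d (x y : image) : im_comp d x -> im_comp d y -> im_comp d (x - y).
Proof. exact: gr_compB. Qed.
Fact im_compZ k d (a : S) (x : image) :
  weyl_deg k a -> im_comp d x -> im_comp (k + d) (a *: x).
Proof. exact: gr_compZ. Qed.

Fact hcomp_im d (y : image) : hcomp d (imval y) \in im_pred.
Proof.
case: y => y /= /boolp.asboolP[x <-]; apply/boolp.asboolP.
by exists (hcomp d x); rewrite hcomp_hom.
Qed.

Lemma imval_sum (s : seq int) (c : int -> image) :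
  imval (\sum_(d <- s) c d) = \sum_(d <- s) imval (c d).
Proof. exact: (raddf_sum (val : {additive image -> N})). Qed.

Fact im_comp_sum (x : image) : exists (s : seq int) (c : int -> image),
  [/\ uniq s, forall d, im_comp d (c d) & x = \sum_(d <- s) c d].
Proof.
exists (hsupp (imval x)), (fun d => Image (hcomp_im d x)); split.
- exact: hsupp_uniq.
- by move=> d; exact: hcompP.
- by apply: val_inj; rewrite /= imval_sum; apply: hcomp_sum (hsupp_uniq _) _.
Qed.

Fact im_comp_free (s : seq int) (c : int -> image) :
  uniq s -> (forall d, im_comp d (c d)) -> \sum_(d <- s) c d = 0 ->
  forall d, d \in s -> c d = 0.
Proof.
move=> us cP /(congr1 imval); rewrite imval_sum => c0 d ds.
by apply: val_inj; exact: (gr_comp_free us cP c0 ds).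
Qed.

Definition image_module : gradedModule A m :=
  GradedModule im_comp0 im_compB im_compZ im_comp_sum im_comp_free.

Fact imval_linear : linear (imval : image_module -> N).
Proof. by move=> a x y. Qed.

Definition image_incl : gradedHom image_module N :=
  mkGradedHom imval_linear (fun d x xd => xd).

(** The form in which injectivity is used to build homotopies: a map to E
    that kills the kernel of f factors through f, because it descends to the
    image of f and then extends to N. *)
Lemma star_injective_factor (E : gradedModule A m) (g : gradedHom M E) :
  star_injective E -> (forall x, f x = 0 -> g x = 0) ->
  exists h : gradedHom N E, forall x, h (f x) = g x.
Proof.
move=> Einj fg.
have fgE x y : f x = f y -> g x = g y.
  move=> fxy; apply: subr0_eq; have := fg (x - y).
  by rewrite !raddfB /= fxy subrr; exact.
have preP (y : image_module) : exists x, f x = imval y.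
  exact: boolp.asboolP (imvalP y).
pose pre y := sval (boolp.cid (preP y)).
have preE y : f (pre y) = imval y by exact: svalP (boolp.cid (preP y)).
have gL : linear (fun y => g (pre y)).
  by move=> a x y; rewrite -linearP; apply: fgE; rewrite linearP !preE.
(* A preimage of a homogeneous y need not be homogeneous, but its component
   in the degree of y is again a preimage. *)
have gC d (y : image_module) : gr_comp d y -> gr_comp d (g (pre y)).
  move=> yd; rewrite (fgE _ (hcomp d (pre y))); last first.
    by rewrite -hcomp_hom preE (hcomp_homog _ (yd : gr_comp d (imval y))) eqxx.
  by apply: gr_map_comp; exact: hcompP.
have incl_inj : injective image_incl by move=> x y; exact: val_inj.
have [h hE] := Einj _ _ image_incl (mkGradedHom gL gC) incl_inj.
exists h => x.
have fx : f x \in im_pred by apply/boolp.asboolP; exists x.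
by rewrite -[f x]/(image_incl (Image fx)) hE /=; apply: fgE; rewrite preE.
Qed.

End Image.

(** * Vanishing of theta on cohomology *)

Section Eulerian.
Variables (A : comNzRingType) (m : nat).
Local Notation S := (weyl A m).
Local Notation euler := (euler A m).
Implicit Types V M N : gradedModule A m.

(** Generalized Eulerian with exponent 1. Vanishing of theta on V makes theta
    null-homotopic on a resolution of V, which mere local nilpotency need not
    do for any power of theta. *)
Definition eulerian V : Prop :=
  forall d (v : V), gr_comp d v -> (euler - d%:~R) *: v = 0.

Lemma eulerian_theta V : eulerian V -> forall v : V, theta v = 0.
Proof.
move=> Veul; elim/homog_ind => [|x y IHx IHy|d x xd]; first exact: raddf0.
  by rewrite raddfD /= IHx IHy addr0.
by rewrite (theta_homog xd) Veul.
Qed.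

Lemma theta_natural M N (f : gradedHom M N) x : theta (f x) = f (theta x).
Proof.
elim/homog_ind: x => [|x y IHx IHy|d x xd]; first by rewrite !raddf0.
  by rewrite !raddfD /= IHx IHy.
by rewrite (theta_homog xd) (theta_homog (gr_map_comp f xd)) linearZ.
Qed.

(** Euler's identity for homogeneous polynomials, read off from
    [euler_comm]: p is the image of 1 under multiplication by p, and euler
    kills 1. *)
Lemma polyRing_eulerian : eulerian (polyRing_module A m).
Proof.
move=> [n|n] p pd; last by rewrite (pd : p = 0) scaler0.
have pE : p = wR p *: (1 : polyS A m) by rewrite -[RHS]/(p * 1) mulr1.
have eul1 : euler *: (1 : polyS A m) = 0 by exact: eulerC.
case: (weyl_deg_wR pd) => [p0|pn]; first by rewrite pE p0 scale0r scaler0.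
rewrite pE scalerA mulrBl (euler_comm pn) mulrDr -(commr_int (wR p) n).
by rewrite addrK -scalerA eul1 scaler0.
Qed.

Section Homotopy.
Variables (V : gradedModule A m) (E : star_injective_resolution V).
Hypothesis Veul : eulerian V.

Lemma res_diffK n (e : E n) : res_diff E n.+1 (res_diff E n e) = 0.
Proof. by apply/res_exact; exists e. Qed.

(** On the kernel of the first differential, which is V, theta is the theta
    of V and so vanishes. *)
Lemma homotopy0 : exists h : gradedHom (E 1%N) (E 0%N),
  forall e, theta e = h (res_diff E 0 e).
Proof.
have [|h hE] := star_injective_factor (f := res_diff E 0)
  (g := theta_hom (E 0%N)) (@res_inj _ _ _ E 0).
  move=> e /res_exact0[v ->].
  by rewrite [LHS]theta_natural eulerian_theta ?raddf0.
by exists h => e; rewrite hE.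
Qed.

(** The map theta - d h vanishes on boundaries by hypothesis, hence on
    cocycles, so it factors through the next differential. *)
Lemma homotopy_step n (h : gradedHom (E n.+1) (E n)) :
  (forall e, res_diff E n (h (res_diff E n e)) = res_diff E n (theta e)) ->
  exists h' : gradedHom (E n.+2) (E n.+1),
    forall e, theta e = res_diff E n (h e) + h' (res_diff E n.+1 e).
Proof.
move=> hE; have [|h' h'E] := star_injective_factor (f := res_diff E n.+1)
  (g := hom_sub_comp (theta_hom (E n.+1)) h (res_diff E n))
  (@res_inj _ _ _ E n.+1).
  move=> e /res_exact[e' ->].
  by rewrite hom_sub_compE hE [theta_hom _ _]theta_natural subrr.
by exists h' => e; rewrite h'E hom_sub_compE addrC subrK.
Qed.

(** theta on the resolution lifts the zero map of V, so it is
    null-homotopic. *)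
Lemma homotopyS n :
  exists (h : gradedHom (E n.+1) (E n)) (h' : gradedHom (E n.+2) (E n.+1)),
    forall e, theta e = res_diff E n (h e) + h' (res_diff E n.+1 e).
Proof.
elim: n => [|n [h [h' h'E]]].
  have [h hE] := homotopy0; exists h; apply: homotopy_step => e.
  by rewrite hE.
exists h'; apply: homotopy_step => e.
by rewrite h'E raddfD /= res_diffK add0r.
Qed.

End Homotopy.

(** What is needed of a functor of supports F so that the argument applies to
    the complex F(E): components let one work with homogeneous cocycles, and
    functoriality lets the homotopy act on F(E). *)
Record graded_subfunctor
    (F : forall M : gradedModule A m, M -> Prop) : Prop := {
  sf0 : forall M, F M 0;
  sfD : forall M x y, F M x -> F M y -> F M (x + y);
  sf_hcomp : forall M d x, F M x -> F M (hcomp d x);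
  sf_hom : forall M N (f : gradedHom M N) x, F M x -> F N (f x)
}.

Lemma subquotient_map0 M (P Q : M -> Prop) (W : gradedModule A m)
    (pi : M -> W) :
  is_subquotient P Q pi -> P 0 -> pi 0 = 0.
Proof.
case=> piL _ _ _ P0; have := piL (-1) 0 0 P0 P0.
by rewrite scaler0 addr0 scaleN1r addNr.
Qed.

(** If x lifts w, then the image of the component of x in the degree of w is
    the component of w. *)
Lemma subquotient_homog M (P Q : M -> Prop) (W : gradedModule A m)
    (pi : M -> W) :
  P 0 -> (forall x y, P x -> P y -> P (x + y)) ->
  (forall d x, P x -> P (hcomp d x)) -> is_subquotient P Q pi ->
  forall d (w : W), gr_comp d w -> exists x, [/\ P x, gr_comp d x & pi x = w].
Proof.
move=> P0 PD Ph Hpi d w wd; have [piL piC pi_onto _] := Hpi.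
have [x [Px xw]] := pi_onto w.
have piD y z : P y -> P z -> pi (y + z) = pi y + pi z.
  by move=> Py Pz; have := piL 1 y z Py Pz; rewrite !scale1r.
exists (hcomp d x); split; [exact: Ph | exact: hcompP |].
have pi_sum (s : seq int) : P (\sum_(e <- s) hcomp e x) /\
    pi (\sum_(e <- s) hcomp e x) = \sum_(e <- s) pi (hcomp e x).
  elim: s => [|e s [Ps IHs]]; first by rewrite !big_nil (subquotient_map0 Hpi).
  rewrite !big_cons -IHs; split; first by apply: PD => //; exact: Ph.
  by apply: piD => //; exact: Ph.
have piCx e : gr_comp e (pi (hcomp e x)) by apply: piC (hcompP e x); exact: Ph.
have xE := hcomp_sum (hsupp_uniq x) (fun e h => h).
have := hcompE d (hsupp_uniq x) piCx.
rewrite -(pi_sum _).2 -xE xw => /(_ _ erefl).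
rewrite (hcomp_homog _ wd) eqxx => ->; case: ifPn => // dx.
by rewrite /hcomp (negPf dx) (subquotient_map0 Hpi).
Qed.

(** On a homogeneous cocycle x lifting w, (euler - d) w is the class of
    theta x = d h x + h' d x. Modulo T(E) the second term vanishes, because
    d x lies in T(E), and the first one is a coboundary of U(E). *)
Lemma cohomology_eulerian V (E : star_injective_resolution V)
    (U T : forall M : gradedModule A m, M -> Prop) i (H : gradedModule A m)
    (pi : E i -> H) :
  eulerian V -> graded_subfunctor U -> graded_subfunctor T ->
  is_cohomology (fun n => U (E n)) (fun n => T (E n)) pi -> eulerian H.
Proof.
move=> Veul sU sT Hpi d w wd.
have [||| x [[Ux Tdx] xd xw]] := subquotient_homog _ _ _ Hpi wd.
- by split; [exact: sf0 | rewrite raddf0; exact: sf0].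
- move=> x y [Ux Tx] [Uy Ty]; split; first exact: sfD.
  by rewrite raddfD; exact: sfD.
- move=> e x [Ux Tx]; split; first exact: sf_hcomp.
  by rewrite -hcomp_hom; exact: sf_hcomp.
have [piL _ _ piQ] := Hpi.
have P0 : cocycle (fun n => U (E n)) (fun n => T (E n)) (0 : E i).
  by split; [exact: sf0 | rewrite raddf0; exact: sf0].
have Px : cocycle (fun n => U (E n)) (fun n => T (E n)) x by [].
have -> : (euler - d%:~R) *: w = pi (theta x).
  rewrite (theta_homog xd) -[_ *: x]addr0 (piL _ _ _ Px P0).
  by rewrite (subquotient_map0 Hpi P0) addr0 xw.
apply/piQ; first split.
- exact: (sf_hom sU (theta_hom (E i))).
- by rewrite -theta_natural; exact: (sf_hom sT (theta_hom (E i.+1))).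
case: i pi Hpi x Ux Tdx xd xw piL piQ P0 Px => [|i] pi Hpi x Ux Tdx *.
  have [h hE] := homotopy0 E Veul.
  by rewrite /= hE; exact: sf_hom.
have [h [h' hE]] := homotopyS E Veul i.
exists (h x); split; first exact: sf_hom.
by rewrite hE addrC addKr; exact: sf_hom.
Qed.

End Eulerian.

(** * Powers of ideals and sections with supports *)

Section Ideals.
Variable B : comNzRingType.
Implicit Types (G I : B -> Prop).

Lemma ideal_gen_is_ideal G : is_ideal (ideal_gen G).
Proof.
split=> [|x y Gx Gy|b x Gx]; first exact: ideal_gen0.
- by elim: Gx => [|c g z Gg _ IH]; rewrite ?add0r // -addrA; apply: ideal_genD.
- elim: Gx => [|c g z Gg _ IH]; first by rewrite mulr0; exact: ideal_gen0.
  by rewrite mulrDr mulrA; apply: ideal_genD.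
Qed.

Lemma mem_ideal_gen G x : G x -> ideal_gen G x.
Proof.
move=> Gx; rewrite -[x]mul1r -[_ * x]addr0.
by apply: ideal_genD => //; exact: ideal_gen0.
Qed.

Lemma ideal_exp_is_ideal I n : is_ideal (ideal_exp I n).
Proof. by case: n => [|n]; [split | exact: ideal_gen_is_ideal]. Qed.

Lemma ideal_exp_leq I n k x : (n <= k)%N -> ideal_exp I k x -> ideal_exp I n x.
Proof.
move=> /subnK <-; elim: (k - n)%N x => // {}k IHk x Ix; apply: IHk.
have [I0 ID IM] := ideal_exp_is_ideal I (k + n).
elim: Ix => // b _ z [y [w [_ Iw ->]]] _ Iz.
by apply: (ID) => //; rewrite mulrA; exact: IM.
Qed.

End Ideals.

Section Gamma.
Variables (A : comNzRingType) (m : nat).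
Implicit Types (M N : gradedModule A m) (Y : hclosed A m).

(** The ideal is generated by homogeneous elements f, and multiplication by
    such an f maps components to components. If I^(n+1) kills x then I^n kills
    f x, hence by induction it kills the components of f x, which are f times
    those of x. *)
Lemma Gamma_hcomp Y M d (x : M) : Gamma Y x -> Gamma Y (hcomp d x).
Proof.
case=> n xn; exists n; elim: n x xn d => [|n IHn] x xn d.
  have -> : x = 0 by rewrite -[x]scale1r -wR1 xn.
  by move=> r _; rewrite raddf0 scaler0.
have fxd f r : f \in equations Y -> ideal_exp (Defs.span (equations Y)) n r ->
    wR r *: (wR f *: hcomp d x) = 0.
  move=> fY rn; have [k fk] := equations_homog fY.
  have [->|fdeg] := weyl_deg_wR fk; first by rewrite scale0r scaler0.
  rewrite -(hcompZ d x fdeg); apply: IHn rn => s sn.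
  rewrite scalerA -wRM mulrC; apply/xn/mem_ideal_gen; exists f, s.
  by split=> //; exact: mem_ideal_gen.
move=> r; elim=> [|b _ z [f [s [fI sn ->]]] _ IHz].
  by rewrite wR0 scale0r.
rewrite wRD scalerDl IHz addr0 wRM -scalerA; apply/eqP.
suff -> : wR (f * s) *: hcomp d x = 0 by rewrite scaler0.
elim: fI => [|c g y gY _ IHy]; first by rewrite mul0r wR0 scale0r.
rewrite mulrDl wRD scalerDl IHy addr0 -mulrA wRM -scalerA.
by rewrite [g * s]mulrC wRM -(scalerA (wR s)) fxd ?scaler0.
Qed.

Lemma Gamma_subfunctor Y : graded_subfunctor (@Gamma A m Y).
Proof.
split=> [M|M x y [n xn] [k yk]|M d x|M N f x [n xn]].
- by exists 0%N => r _; rewrite scaler0.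
- exists (maxn n k) => r rI.
  have nI := ideal_exp_leq (leq_maxl n k) rI.
  have kI := ideal_exp_leq (leq_maxr n k) rI.
  by rewrite scalerDr xn // yk // addr0.
- exact: Gamma_hcomp.
- by exists n => r rI; rewrite -linearZ /= xn ?raddf0.
Qed.

(** Cohomology with supports in a closed subset is the case T = 0 of the
    cohomology of U(E)/T(E). *)
Lemma zero_subfunctor :
  graded_subfunctor (fun (M : gradedModule A m) (x : M) => x = 0).
Proof.
split=> // [M x y -> ->|M d x ->|M N f x ->]; rewrite ?addr0 ?raddf0 //.
Qed.

(** The kernel of an arrow of the long exact sequence embeds into the source
    of the arrow, which is a local cohomology module. *)
Lemma basic_value_eulerian (T : basic_functor A m) V W :
  basic_value T V W -> eulerian V -> eulerian W.
Proof.
case=> E TW Veul.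
have closedE Y i (H : gradedModule A m) (pi : E i -> H) :
    is_H_closed Y pi -> eulerian H.
  exact: cohomology_eulerian Veul (Gamma_subfunctor Y) zero_subfunctor.
have locclosedE (Y : hlocclosed A m) i (H : gradedModule A m) (pi : E i -> H) :
    is_H_locclosed Y pi -> eulerian H.
  exact: cohomology_eulerian Veul (Gamma_subfunctor _) (Gamma_subfunctor _).
case: T TW => [i Y [pi]|a Y [M [N [f [fa [j [j_inj _]]]]]]].
  exact: locclosedE.
suff Meul : eulerian M.
  move=> d w wd; apply: j_inj.
  by rewrite linearZ /= raddf0 (Meul _ _ (gr_map_comp j wd)).
case: a fa => i [pi [pi' [piH _ _]]].
- exact: closedE piH.
- exact: closedE piH.
- exact: locclosedE piH.
Qed.

End Gamma.

Theorem theorem1p16 (A : comNzRingType) (m : nat)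
    (A_regular : is_regular_ring A)
    (A_field : contains_field_char0 A)
    (m_gt0 : (0 < m)%N)
    (G : lyubeznik_functor A m)
    (W : gradedModule A m)
    (W_value : lyubeznik_value G (polyRing_module A m) W) :
  generalized_Eulerian W.
Proof.
suff Weul : eulerian W by move=> d w wd; exists 1%N; rewrite expr1 Weul.
elim: G W W_value => [T|T G IHG] W.
  by move/basic_value_eulerian; apply; exact: polyRing_eulerian.
by case=> U [/IHG Ueul] /basic_value_eulerian; apply.
Qed.
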